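(* Let $m,n,s,k$ be integers with $m+s\ge n\ge s\ge 0$ and $k\le n$. Let $\mathbb{S}_1\subseteq\mathbb{R}^{m\times n}$ and $\mathbb{S}_2\subseteq\mathbb{R}^{s\times n}$ be linear subspaces (of structured matrices) with structure matrices $\Phi_{\mathbb{S}_1}\in\mathbb{R}^{mn\times k_1}$, $\Phi_{\mathbb{S}_2}\in\mathbb{R}^{sn\times k_2}$ as described in the context. Let $A\in\mathbb{S}_1$, $B\in\mathbb{S}_2$, $b\in\mathbb{R}^m$, $d\in\mathbb{R}^s$ satisfy $\mathrm{rank}(B)=s$ and $\mathrm{null}(A)\cap\mathrm{null}(B)=\{0\}$, let $L\in\mathbb{R}^{n\times k}$, and let $\alpha_A,\alpha_B,\alpha_b,\alpha_d>0$. Let $x=x(A,B,b,d)$ be the unique solution of $\min_{Bx=d}\|b-Ax\|_2$ and $r=b-Ax$. Then the structured partial condition number with respect to $L$ and the structures $\mathbb{S}_1,\mathbb{S}_2$ (defined in the context) is $$\kappa^S_{LSE}(A,B,b,d)=\left\|M_{g'}\begin{bmatrix}\Phi_{\mathbb{S}_1}D_1^{-1}&0&0&0\\0&\Phi_{\mathbb{S}_2}D_2^{-1}&0&0\\0&0&I_m&0\\0&0&0&I_s\end{bmatrix}\right\|_2,$$ where, for $i=1,2$, $D_i$ is the $k_i\times k_i$ diagonal matrix whose $j$-th diagonal entry is the Euclidean norm of the $j$-th column of $\Phi_{\mathbb{S}_i}$, and $M_{g'}=[M_1,M_2,M_3,M_4]$ with $$M_1=\frac{\left(r^T\otimes (L^T((AP)^TAP)^\dagger)\right)\Pi_{mn}-x^T\otimes(L^T(AP)^\dagger)}{\alpha_A},$$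 $$M_2=-\frac{\left((r^TAB_A^\dagger)\otimes(L^T((AP)^TAP)^\dagger)\right)\Pi_{sn}+x^T\otimes(L^TB_A^\dagger)}{\alpha_B},$$ $$M_3=\frac{L^T(AP)^\dagger}{\alpha_b},\qquad M_4=\frac{L^TB_A^\dagger}{\alpha_d}.$$
   Context: For a matrix $C$, $C^\dagger$ is the Moore-Penrose inverse, $\|C\|_2$ the spectral norm and $\|C\|_F$ the Frobenius norm; $\otimes$ is the Kronecker product. $P=I_n-B^\dagger B$ and $B_A^\dagger=(I_n-(AP)^\dagger A)B^\dagger$. The vec operator stacks the columns of a matrix into one vector. $\Pi_{pq}$ denotes the vec-permutation matrix, i.e. the $pq\times pq$ permutation matrix with $\Pi_{pq}\,\mathrm{vec}(Y)=\mathrm{vec}(Y^T)$ for all $Y\in\mathbb{R}^{p\times q}$. Structure matrices: $\Phi_{\mathbb{S}_i}$ ($i=1,2$) is a fixed matrix with nonzero, mutually orthogonal columns (not necessarily of unit norm) such that a matrix $Y$ of the appropriate size lies in $\mathbb{S}_i$ if and only if $\mathrm{vec}(Y)=\Phi_{\mathbb{S}_i}s_i$ for some parameter vector $s_i\in\mathbb{R}^{k_i}$. Under the rank conditions $\mathrm{rank}(B)=s$, $\mathrm{null}(A)\cap\mathrm{null}(B)=\{0\}$, the problem $\min_{Bx=d}\|b-Ax\|_2$ has the unique solution $x(A,B,b,d)=(AP)^\dagger b+B_A^\dagger d$. Define $g(A,B,b,d)=L^Tx(A,B,b,d)\in\mathbb{R}^k$; $g$ is continuously Fréchet differentiable in a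 neighborhood of $(A,B,b,d)$ in $\mathbb{R}^{m\times n}\times\mathbb{R}^{s\times n}\times\mathbb{R}^m\times\mathbb{R}^s$, and $g'(A,B,b,d)$ denotes its Fréchet derivative (a linear map) there. The weighted Frobenius norm is $$\|(\alpha_A\Delta A,\alpha_B\Delta B,\alpha_b\Delta b,\alpha_d\Delta d)\|_F=\sqrt{\alpha_A^2\|\Delta A\|_F^2+\alpha_B^2\|\Delta B\|_F^2+\alpha_b^2\|\Delta b\|_2^2+\alpha_d^2\|\Delta d\|_2^2}.$$ The structured partial condition number is $$\kappa^S_{LSE}(A,B,b,d)=\max_{\substack{(\Delta A,\Delta B,\Delta b,\Delta d)\ne0\\ \Delta A\in\mathbb{S}_1,\ \Delta B\in\mathbb{S}_2}}\frac{\|g'(A,B,b,d)(\Delta A,\Delta B,\Delta b,\Delta d)\|_2}{\|(\alpha_A\Delta A,\alpha_B\Delta B,\alpha_b\Delta b,\alpha_d\Delta d)\|_F},$$ with $\Delta b\in\mathbb{R}^m$, $\Delta d\in\mathbb{R}^s$ arbitrary. *)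

(* Defs.v *)
From HB Require Import structures.
From mathcomp Require Import all_boot all_order all_algebra.
From mathcomp.real_closed Require Import mxtens.
From mathcomp Require Import all_classical all_reals all_analysis.

Set Implicit Arguments.
Unset Strict Implicit.
Unset Printing Implicit Defensive.

Import Order.TTheory GRing.Theory Num.Theory.
Import numFieldNormedType.Exports.
Local Open Scope classical_set_scope.
Local Open Scope ring_scope.

Definition l2norm (R : realType) (n : nat) (v : 'cV[R]_n) : R :=
  Num.sqrt (\sum_(i < n) v i 0 ^+ 2).

Definition frobnorm (R : realType) (m n : nat) (C : 'M[R]_(m, n)) : R :=
  Num.sqrt (\sum_(i < m) \sum_(j < n) C i j ^+ 2).

(* The constraint is [<= 1] rather than [= 1] so that matrices without
   columns have norm 0. *)
Definition specnorm (R : realType) (m n : nat) (C : 'M[R]_(m, n)) : R :=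
  sup [set l2norm (C *m v) | v in [set v : 'cV[R]_n | l2norm v <= 1]].

(* The value is 0 when S has no greatest element. *)
Definition setmax (R : realType) (S : set R) : R := xget 0 (S `&` ubound S).

Lemma setmaxP (R : realType) (S : set R) (v : R) :
  S v -> ubound S v -> setmax S = v.
Proof.
move=> Sv uv; apply: xget_unique; first by split.
by move=> w [Sw uw]; apply/le_anti; rewrite uv ?uw.
Qed.

Definition moore_penrose (R : realType) (m n : nat)
    (C : 'M[R]_(m, n)) (X : 'M[R]_(n, m)) : Prop :=
  [/\ C *m X *m C = C, X *m C *m X = X,
      (C *m X)^T = C *m X & (X *m C)^T = X *m C].

Definition pinv (R : realType) (m n : nat) (C : 'M[R]_(m, n)) : 'M[R]_(n, m) :=
  xget 0 [set X | moore_penrose C X].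

Lemma gram_unitmx (R : realType) (r n : nat) (G : 'M[R]_(r, n)) :
  row_free G -> G *m G^T \in unitmx.
Proof.
move=> fG; rewrite -row_free_unit -kermx_eq0 in fG *.
rewrite -kermx_eq0; apply/eqP/row_matrixP => i; rewrite row0.
set u := row i _.
have uGG : u *m (G *m G^T) = 0.
  by apply/sub_kermxP; rewrite /u row_sub.
have : (u *m G) *m (u *m G)^T = 0.
  by rewrite trmx_mul !mulmxA -(mulmxA u) uGG mul0mx.
move=> /matrixP /(_ 0 0); rewrite !mxE => uu.
have uG : u *m G = 0.
  apply/matrixP => a j; rewrite (ord1 a) [RHS]mxE; apply/eqP.
  rewrite -sqrf_eq0 expr2.
  have := psumr_eq0P _ uu; move=> /(_ _ j isT) <-; first by rewrite [_^T _ _]mxE.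
  by move=> k _; rewrite [_^T _ _]mxE -expr2 sqr_ge0.
by apply/eqP; rewrite -submx0 -(eqP fG); apply/sub_kermxP.
Qed.

Lemma moore_penrose_unique (R : realType) (m n : nat) (C : 'M[R]_(m, n)) X Y :
  moore_penrose C X -> moore_penrose C Y -> X = Y.
Proof.
move=> [X1 X2 X3 X4] [Y1 Y2 Y3 Y4].
have CXY : C *m X = C *m Y.
  by rewrite -X3 -[in LHS]Y1 -mulmxA trmx_mul X3 Y3 mulmxA X1.
have XYC : X *m C = Y *m C.
  by rewrite -X4 -[in LHS]Y1 -!mulmxA mulmxA trmx_mul Y4 X4 -!mulmxA (mulmxA C) X1.
by rewrite -X2 XYC -mulmxA CXY mulmxA Y2.
Qed.

Lemma moore_penrose_mul (R : realType) (m n r : nat)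
    (F : 'M[R]_(m, r)) (G : 'M[R]_(r, n)) :
  row_full F -> row_free G ->
  moore_penrose (F *m G)
    (G^T *m invmx (G *m G^T) *m (invmx (F^T *m F) *m F^T)).
Proof.
move=> fF fG; have uG : G *m G^T \in unitmx by rewrite gram_unitmx.
have uF : F^T *m F \in unitmx.
  by rewrite -{2}[F]trmxK gram_unitmx // /row_free mxrank_tr.
set GG := invmx (G *m G^T); set FF := invmx (F^T *m F).
have CX : F *m G *m (G^T *m GG *m (FF *m F^T)) = F *m FF *m F^T.
  by rewrite !mulmxA -(mulmxA F) -(mulmxA F) mulmxV // mulmx1.
have XC : (G^T *m GG *m (FF *m F^T)) *m (F *m G) = G^T *m GG *m G.
  by rewrite !mulmxA -(mulmxA _ F^T) -(mulmxA _ FF) mulVmx // mulmx1.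
have GGt : GG^T = GG by rewrite /GG trmx_inv trmx_mul trmxK.
have FFt : FF^T = FF by rewrite /FF trmx_inv trmx_mul trmxK.
split.
- by rewrite CX !mulmxA -(mulmxA _ F^T) -(mulmxA _ FF) mulVmx // mulmx1.
- rewrite XC !mulmxA -(mulmxA _ G) -(mulmxA _ (G *m _)).
  by rewrite mulmxV // mulmx1.
- by rewrite CX !trmx_mul trmxK FFt mulmxA.
- by rewrite XC !trmx_mul trmxK GGt mulmxA.
Qed.

Lemma pinvP (R : realType) (m n : nat) (C : 'M[R]_(m, n)) :
  moore_penrose C (pinv C).
Proof.
have := moore_penrose_mul (col_base_full C) (row_base_free C).
by rewrite mulmx_base; apply: (@xgetI _ 0 [set X | moore_penrose C X]).
Qed.

(* Indexing follows [tensmx]: position [j * m + i] of [vec Y] is [Y i j]. *)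
Definition vec (R : realType) (m n : nat) (Y : 'M[R]_(m, n)) : 'cV[R]_(n * m) :=
  \col_l Y (mxtens_unindex l).2 (mxtens_unindex l).1.

Definition vecperm (R : realType) (p q : nat) : 'M[R]_(p * q, q * p) :=
  \matrix_(i, j) (mxtens_unindex i ==
    ((mxtens_unindex j).2, (mxtens_unindex j).1))%:R.

Lemma vecpermE (R : realType) (p q : nat) (Y : 'M[R]_(p, q)) :
  vecperm R p q *m vec Y = vec Y^T.
Proof.
apply/colP => i; case: (mxtens_indexP i) => a c; rewrite !mxE mxtens_indexK /=.
rewrite (bigD1 (mxtens_index (c, a))) //= big1 => [|j ne]; rewrite !mxE.
  by rewrite !mxtens_indexK /= eqxx mul1r addr0.
case: (mxtens_indexP j) ne => c' a'; rewrite !mxtens_indexK /= => ne.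
case: eqP => [[ea ec]|]; last by rewrite mul0r.
by rewrite ea ec eqxx in ne.
Qed.

(* [tensmx] is the Kronecker product; with a row vector on the left its row
   dimension is [1 * k], hence the cast. *)
Definition rowkron (R : realType) (k p q : nat)
    (u : 'rV[R]_p) (C : 'M[R]_(k, q)) : 'M[R]_(k, p * q) :=
  castmx (mul1n k, erefl (p * q)%N) (tensmx u C).

Definition structure_matrix (R : realType) (m n l : nat)
    (S : {vspace 'M[R]_(m, n)}) (Phi : 'M[R]_(n * m, l)) : Prop :=
  [/\ forall j, col j Phi != 0,
      forall i j, i != j -> (col i Phi)^T *m col j Phi = 0 &
      forall Y, Y \in S <-> exists t : 'cV[R]_l, vec Y = Phi *m t].

Definition colnorms (R : realType) (p l : nat) (Phi : 'M[R]_(p, l)) : 'M[R]_l :=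
  diag_mx (\row_j l2norm (col j Phi)).

Section LSE.
Context {R : realType} {m n s k : nat}.
Implicit Types (A : 'M[R]_(m, n)) (B : 'M[R]_(s, n)).
Implicit Types (b : 'cV[R]_m) (d : 'cV[R]_s) (L : 'M[R]_(n, k)).

Definition lse_minimizer A B b d (x : 'cV[R]_n) : Prop :=
  B *m x = d /\
  forall y, B *m y = d -> l2norm (b - A *m x) <= l2norm (b - A *m y).

(* Meaningful where the minimizer is unique, see [lse_minimizerE] below. *)
Definition lse_sol A B b d : 'cV[R]_n :=
  xget 0 [set x | lse_minimizer A B b d x].

Definition projP B : 'M[R]_n := 1%:M - pinv B *m B.

Definition pinvBA A B : 'M[R]_(n, s) :=
  (1%:M - pinv (A *m projP B) *m A) *m pinv B.

Lemma lse_minimizerE A B b d (x : 'cV[R]_n) :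
  \rank B = s -> (forall v : 'cV[R]_n, A *m v = 0 -> B *m v = 0 -> v = 0) ->
  lse_minimizer A B b d x <-> x = pinv (A *m projP B) *m b + pinvBA A B *m d.
Proof.
move=> rB nAB; have [B1 B2 B3 B4] := pinvP B.
set x0 := _ + _; set P := projP B in x0 *; set Q := pinv (A *m P) in x0 *.
have x0E : x0 = Q *m b + (1%:M - Q *m A) *m (pinv B *m d).
  by rewrite /x0 /pinvBA -/P -/Q mulmxA.
have PE : P = 1%:M - pinv B *m B by [].
have [Q1 Q2 Q3 Q4] : moore_penrose (A *m P) Q by exact: pinvP.
clearbody x0 Q P.
have BBi : B *m pinv B = 1%:M.
  by apply: (@row_free_inj _ _ _ _ B); rewrite /row_free ?rB// B1 mul1mx.
have BP : B *m P = 0 by rewrite PE mulmxBr mulmx1 mulmxA B1 subrr.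
have PP : P *m P = P by rewrite {1}PE mulmxBl mul1mx -mulmxA BP mulmx0 subr0.
have PT : P^T = P by rewrite PE linearB /= trmx1 B4.
have PQA : P *m (Q *m (A *m P)) = Q *m (A *m P).
  by rewrite -Q4 !trmx_mul PT !mulmxA PP.
have PQ : P *m Q = Q by rewrite -{1}Q2 mulmxA PQA Q2.
have BQ : B *m Q = 0 by rewrite -PQ mulmxA BP mul0mx.
have Bx0 : B *m x0 = d.
  rewrite x0E mulmxDr !mulmxA BQ mul0mx add0r.
  by rewrite mulmxBr mulmx1 !mulmxA BQ mul0mx subr0 BBi mul1mx.
have APQ : (A *m P)^T *m (A *m Q) = (A *m P)^T.
  by rewrite -{1}PQ (mulmxA A P) -Q3 -trmx_mul Q1.
have r0 : (A *m P)^T *m (b - A *m x0) = 0.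
  have APQv (v : 'cV[R]_m) : (A *m P)^T *m (A *m (Q *m v)) = (A *m P)^T *m v.
    by rewrite (mulmxA A) mulmxA APQ.
  rewrite mulmxBr x0E !mulmxDr APQv opprD addrA subrr add0r.
  by rewrite mulmxBl mul1mx -[Q *m A *m _]mulmxA !mulmxBr APQv subrr oppr0.
have pyth y : B *m y = d ->
    \sum_i (b - A *m y) i 0 ^+ 2 =
    \sum_i (b - A *m x0) i 0 ^+ 2 + \sum_i (A *m (y - x0)) i 0 ^+ 2.
  move=> By; set z := y - x0; set r := b - A *m x0.
  have Bz : B *m z = 0 by rewrite mulmxBr By Bx0 subrr.
  have Pz : P *m z = z.
    by rewrite PE mulmxBl mul1mx -mulmxA Bz mulmx0 subr0.
  have rz : (A *m z)^T *m r = 0.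
    by rewrite -Pz mulmxA trmx_mul -mulmxA r0 mulmx0.
  have -> : b - A *m y = r - A *m z.
    by rewrite /r /z mulmxBr opprB addrA subrK.
  move/matrixP: rz => /(_ 0 0); rewrite !mxE => rz.
  transitivity (\sum_i (r i 0 ^+ 2 + (A *m z) i 0 ^+ 2
      - (A *m z)^T 0 i * r i 0 *+ 2)).
    apply: eq_bigr => i _; rewrite [(r - _) i 0]mxE [(- (A *m z)) i 0]mxE.
    by rewrite [(A *m z)^T 0 i]mxE sqrrB [_ * r i 0]mulrC addrAC.
  by rewrite sumrB sumrMnl rz mul0rn subr0 big_split.
have sq0 p (v : 'cV[R]_p) : 0 <= \sum_i v i 0 ^+ 2.
  by apply: sumr_ge0 => i _; exact: sqr_ge0.
split=> [[By /(_ _ Bx0)]|->].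
  rewrite /l2norm ler_sqrt // pyth // gerDl => Az0.
  have Bz : B *m (x - x0) = 0 by rewrite mulmxBr By Bx0 subrr.
  apply/eqP; rewrite -subr_eq0; apply/eqP/nAB => //; apply/colP => i.
  have /psumr_eq0P : \sum_i (A *m (x - x0)) i 0 ^+ 2 = 0.
    by apply/le_anti; rewrite Az0 sq0.
  move=> /(_ (fun i _ => sqr_ge0 _)) /(_ i isT) /eqP.
  by rewrite sqrf_eq0 => /eqP ->; rewrite mxE.
split=> // y By; rewrite /l2norm ler_sqrt //.
by rewrite [leRHS]pyth // lerDl.
Qed.

Definition lse_g L
    (p : 'M[R]_(m, n) * 'M[R]_(s, n) * 'cV[R]_m * 'cV[R]_s) : 'cV[R]_k :=
  let: (A, B, b, d) := p in L^T *m lse_sol A B b d.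

Definition weighted_frobnorm (aA aB ab ad : R)
    (h : 'M[R]_(m, n) * 'M[R]_(s, n) * 'cV[R]_m * 'cV[R]_s) : R :=
  let: (dA, dB, db, dd) := h in
  Num.sqrt (aA ^+ 2 * frobnorm dA ^+ 2 + aB ^+ 2 * frobnorm dB ^+ 2 +
            ab ^+ 2 * l2norm db ^+ 2 + ad ^+ 2 * l2norm dd ^+ 2).

(* The library norm on the product of matrix spaces is a max norm; as all norms
   in finite dimension are equivalent, ['d] is still the Frechet derivative. *)
Definition kappaS (S1 : {vspace 'M[R]_(m, n)}) (S2 : {vspace 'M[R]_(s, n)})
    (aA aB ab ad : R) L A B b d : R :=
  setmax [set l2norm ('d (lse_g L) (A, B, b, d) h) /
              weighted_frobnorm aA aB ab ad h | h in
    [set h | [/\ h != 0, h.1.1.1 \in S1 & h.1.1.2 \in S2]]].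

Definition M1 (aA : R) L A B (x : 'cV[R]_n) (r : 'cV[R]_m) : 'M[R]_(k, n * m) :=
  let AP := A *m projP B in
  aA^-1 *: (rowkron r^T (L^T *m pinv (AP^T *m AP)) *m vecperm R m n
            - rowkron x^T (L^T *m pinv AP)).

Definition M2 (aB : R) L A B (x : 'cV[R]_n) (r : 'cV[R]_m) : 'M[R]_(k, n * s) :=
  let AP := A *m projP B in
  - (aB^-1 *: (rowkron (r^T *m A *m pinvBA A B) (L^T *m pinv (AP^T *m AP))
                 *m vecperm R s n
               + rowkron x^T (L^T *m pinvBA A B))).

Definition M3 (ab : R) L A B : 'M[R]_(k, m) :=
  ab^-1 *: (L^T *m pinv (A *m projP B)).

Definition M4 (ad : R) L A B : 'M[R]_(k, s) := ad^-1 *: (L^T *m pinvBA A B).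

Definition Mg (aA aB ab ad : R) L A B (x : 'cV[R]_n) (r : 'cV[R]_m) :
    'M[R]_(k, n * m + (n * s + (m + s))) :=
  row_mx (M1 aA L A B x r)
    (row_mx (M2 aB L A B x r) (row_mx (M3 ab L A B) (M4 ad L A B))).

End LSE.

Definition struct_block (R : realType) (m n s k1 k2 : nat)
    (Phi1 : 'M[R]_(n * m, k1)) (Phi2 : 'M[R]_(n * s, k2)) :
    'M[R]_(n * m + (n * s + (m + s)), k1 + (k2 + (m + s))) :=
  block_mx (Phi1 *m invmx (colnorms Phi1)) 0 0
    (block_mx (Phi2 *m invmx (colnorms Phi2)) 0 0
       (block_mx 1%:M 0 0 1%:M)).

(* Main.v *)
(** The constrained minimizer x is the last block of the solution of the
    symmetric system r + A x = b, B x = d, A^T r + B^T u = 0, whose matrix is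
    invertible exactly under the rank conditions and depends affinely on the
    data. A perturbation (E, e) of an invertible system K z = w changes z by
    K^-1 (e - E z) up to a quadratic remainder, which yields the Frechet
    derivative of the solution; eliminating dr and du from the linearized
    system, with the help of u^T = - r^T A B_A^+, gives its closed form.
    The columns of Phi D^-1 being orthonormal, the block matrix is an isometry
    whose range consists of the weighted vectors of the structured
    perturbations, so the condition number is the maximum of |C v| / |v|,
    attained by compactness of the unit ball. *)

Require Import Defs.
From HB Require Import structures.
From mathcomp Require Import all_boot all_order all_algebra.
From mathcomp Require Import ring lra.
From mathcomp.real_closed Require Import mxtens.
From mathcomp Require Import all_classical all_reals all_analysis.

Set Implicit Arguments.
Unset Strict Implicit.
Unset Printing Implicit Defensive.

Import Order.TTheory GRing.Theory Num.Theory.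
Import numFieldNormedType.Exports.
Local Open Scope ring_scope.

Local Notation pinv := Defs.pinv.

(** * Perturbation of linear systems *)

Lemma unitmx_cV_inj (F : fieldType) (n : nat) (M : 'M[F]_n) :
  (forall v : 'cV[F]_n, M *m v = 0 -> v = 0) -> M \in unitmx.
Proof.
move=> inj; rewrite -unitmx_tr -row_free_unit -kermx_eq0.
apply/eqP/row_matrixP => i; rewrite row0; apply: trmx_inj; rewrite trmx0.
apply: inj; apply: trmx_inj; rewrite trmx_mul trmxK trmx0.
by apply/sub_kermxP; rewrite row_sub.
Qed.

Lemma mx_norm_entry (R : realType) (m n : nat) (M : 'M[R]_(m, n)) i j :
  `|M i j| <= `|M|.
Proof. by rewrite [leRHS]mx_normrE (le_bigmax _ (fun ij => `|M ij.1 ij.2|) (i, j)). Qed.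

Lemma mx_norm_le (R : realType) (m n : nat) (M : 'M[R]_(m, n)) (c : R) :
  0 <= c -> (forall i j, `|M i j| <= c) -> `|M| <= c.
Proof. by move=> c0 h; rewrite [leLHS]mx_normrE; apply/bigmax_leP; split. Qed.

(** The norm is the largest absolute entry, which is not submultiplicative; each entry of the
    product is a sum of [n] terms, hence the factor [n%:R]. *)
Lemma mx_norm_mulmx (R : realType) (m n p : nat)
    (M : 'M[R]_(m, n)) (N : 'M[R]_(n, p)) :
  `|M *m N| <= n%:R * `|M| * `|N|.
Proof.
apply: mx_norm_le => [|i j]; first by rewrite !mulr_ge0.
rewrite mxE (le_trans (ler_norm_sum _ _ _))//.
rewrite (@le_trans _ _ (\sum_(l < n) `|M| * `|N|))//.
  by apply: ler_sum => l _; rewrite normrM ler_pM ?mx_norm_entry.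
by rewrite sumr_const card_ord -mulrA mulr_natl.
Qed.

Section PerturbedSystem.
Context {R : realType} {n : nat}.
Variables (K : 'M[R]_n) (z : 'cV[R]_n).
Hypothesis uK : K \in unitmx.

Let c := n%:R * `|invmx K|.
Let c_ge0 : 0 <= c. Proof. by rewrite mulr_ge0. Qed.
(** Chosen so that [c * n%:R * eps <= 2^-1], which makes [invmx K *m E] a contraction; the summand
    [1] keeps the denominator positive even if [c = 0]. *)
Let eps := (2 * (c * n%:R + 1))^-1.
Let cn_ge0 : 0 <= c * n%:R. Proof. by rewrite mulr_ge0. Qed.

Let eps_gt0 : 0 < eps. Proof. by rewrite invr_gt0 mulr_gt0// ltr_wpDl. Qed.

Let contraction (E : 'M[R]_n) (v : 'cV[R]_n) (t : R) :
  t <= eps -> `|E| <= t -> `|invmx K *m (E *m v)| <= 2^-1 * `|v|.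
Proof.
move=> te Et; apply: le_trans (mx_norm_mulmx _ _) _; rewrite -/c.
apply: le_trans (ler_wpM2l c_ge0 (mx_norm_mulmx _ _)) _.
rewrite !mulrA ler_wpM2r//; apply: le_trans (ler_wpM2l cn_ge0 (le_trans Et te)) _.
rewrite /eps; move: (c * n%:R) cn_ge0 => q q0.
by rewrite ler_pdivrMr; lra.
Qed.

(** A kernel vector satisfies [v = - invmx K *m (E *m v)], so its norm is at most half of itself. *)
Lemma perturbed_unitmx : exists2 e : R, 0 < e &
  forall E : 'M[R]_n, `|E| <= e -> K + E \in unitmx.
Proof.
exists eps => [|E Ee]; first exact: eps_gt0.
apply: unitmx_cV_inj => v /eqP; rewrite mulmxDl addr_eq0 => /eqP Kv.
have := contraction v (lexx eps) Ee.
rewrite -[E *m v]opprK -Kv mulmxN mulKmx// normrN => hv.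
by apply/eqP; rewrite -normr_le0; lra.
Qed.

(* With [y = zE - z], [y = invmx K *m (e - E *m z - E *m y)]: a first use gives
   [y = O(t)], a second one bounds the remainder [invmx K *m (E *m y)]. *)
Lemma perturbed_solution : exists2 C : R, 0 <= C & exists2 e0 : R, 0 < e0 &
  forall (E : 'M[R]_n) (e zE : 'cV[R]_n) (t : R),
    t <= e0 -> `|E| <= t -> `|e| <= t -> (K + E) *m zE = K *m z + e ->
    `|zE - z - invmx K *m (e - E *m z)| <= C * t ^+ 2.
Proof.
exists (c * n%:R * (2 * c * (1 + n%:R * `|z|))).
  by rewrite !mulr_ge0// addr_ge0// mulr_ge0.
exists eps => [|E e zE t te Et et eq]; first exact: eps_gt0.
have t0 : 0 <= t by apply: le_trans Et.
set y := zE - z.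
have Ky : invmx K *m (e - E *m z) = y + invmx K *m (E *m y).
  rewrite -{1}[y](mulKmx uK) -mulmxDr; congr (_ *m _).
  have -> : e = (K + E) *m zE - K *m z by rewrite eq addrAC subrr add0r.
  by rewrite mulmxDl /y !mulmxBr; apply/matrixP => i j; rewrite !mxE; ring.
rewrite Ky opprD addrA subrr sub0r normrN.
(* The term [q] has at most half the norm of [y] and is absorbed: [y] is at most twice as large as
   [invmx K *m (e - E *m z)]. *)
have yt : `|y| <= 2 * c * (1 + n%:R * `|z|) * t.
  have := contraction y te Et; set q := invmx K *m (E *m y) in Ky *.
  have -> : y = invmx K *m (e - E *m z) - q by rewrite Ky addrK.
  have := ler_normB (invmx K *m (e - E *m z)) q.
  have : `|invmx K *m (e - E *m z)| <= c * ((1 + n%:R * `|z|) * t).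
    apply: le_trans (mx_norm_mulmx _ _) _; rewrite -/c ler_wpM2l//.
    apply: le_trans (ler_normB _ _) _; rewrite mulrDl mul1r lerD//.
    apply: le_trans (mx_norm_mulmx _ _) _.
    by rewrite -!mulrA ler_wpM2l// mulrC ler_wpM2l.
  have -> : 2 * c * (1 + n%:R * `|z|) * t = 2 * (c * ((1 + n%:R * `|z|) * t)) by ring.
  by move: (c * _) => a; lra.
apply: le_trans (mx_norm_mulmx _ _) _; rewrite -/c.
apply: le_trans (ler_wpM2l c_ge0 (mx_norm_mulmx _ _)) _.
set w := 2 * c * _ in yt *.
have -> : c * n%:R * w * t ^+ 2 = c * (n%:R * (t * (w * t))) by ring.
by rewrite -(mulrA n%:R) !ler_wpM2l// ler_pM.
Qed.

End PerturbedSystem.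

(** * The symmetric system of the constrained problem *)

Lemma l2norm_ge0 (R : realType) (n : nat) (v : 'cV[R]_n) : 0 <= l2norm v.
Proof. exact: sqrtr_ge0. Qed.

Lemma l2norm_sqr (R : realType) (n : nat) (v : 'cV[R]_n) :
  l2norm v ^+ 2 = \sum_i v i 0 ^+ 2.
Proof. by rewrite sqr_sqrtr// sumr_ge0// => i _; exact: sqr_ge0. Qed.

Lemma l2norm_dot (R : realType) (n : nat) (v : 'cV[R]_n) :
  l2norm v ^+ 2 = (v^T *m v) 0 0.
Proof. by rewrite l2norm_sqr mxE; apply: eq_bigr => i _; rewrite mxE expr2. Qed.

Lemma l2norm_eq0 (R : realType) (n : nat) (v : 'cV[R]_n) :
  (l2norm v == 0) = (v == 0).
Proof.
apply/eqP/eqP => [v0|->].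
  have := l2norm_sqr v; rewrite v0 expr0n => /esym/psumr_eq0P v_eq0.
  apply/colP => i; rewrite mxE; apply/eqP; rewrite -sqrf_eq0 v_eq0//.
  by move=> j _; exact: sqr_ge0.
apply/eqP; rewrite -sqrf_eq0 l2norm_sqr big1// => i _.
by rewrite mxE expr0n.
Qed.

Section KKT.
Context {R : realType} {m n s : nat}.
Implicit Types (A : 'M[R]_(m, n)) (B : 'M[R]_(s, n)).

(* Symmetric system in (residual, multiplier, solution): unlike the normal
   equations it is affine in (A, B) and linear in (b, d). *)
Definition kkt A B : 'M[R]_(m + s + n) :=
  block_mx (block_mx 1%:M 0 0 0) (col_mx A B) (row_mx A^T B^T) 0.

(** The constant identity block is dropped, so that perturbing the data changes [kkt] by exactly
    this matrix. *)
Definition kkt_lin A B : 'M[R]_(m + s + n) :=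
  block_mx 0 (col_mx A B) (row_mx A^T B^T) 0.

Definition kkt_rhs (b : 'cV[R]_m) (d : 'cV[R]_s) : 'cV[R]_(m + s + n) :=
  col_mx (col_mx b d) 0.

Lemma kktD A B dA dB : kkt (A + dA) (B + dB) = kkt A B + kkt_lin dA dB.
Proof.
rewrite /kkt /kkt_lin add_block_mx add_col_mx addr0 !linearD/= addr0.
by rewrite add_row_mx.
Qed.

Lemma kkt_mulmx A B (r : 'cV[R]_m) (u : 'cV[R]_s) (x : 'cV[R]_n) :
  kkt A B *m col_mx (col_mx r u) x =
  col_mx (col_mx (r + A *m x) (B *m x)) (A^T *m r + B^T *m u).
Proof.
rewrite mul_block_col mul_block_col !mul_col_mx mul_row_col mul1mx !mul0mx.
by rewrite !addr0 add_col_mx add0r.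
Qed.

Lemma kkt_lin_mulmx A B (r : 'cV[R]_m) (u : 'cV[R]_s) (x : 'cV[R]_n) :
  kkt_lin A B *m col_mx (col_mx r u) x =
  col_mx (col_mx (A *m x) (B *m x)) (A^T *m r + B^T *m u).
Proof.
by rewrite mul_block_col !mul_col_mx mul_row_col !mul0mx addr0 add0r.
Qed.

Lemma kkt_lin_norm A B t : `|A| <= t -> `|B| <= t -> `|kkt_lin A B| <= t.
Proof.
move=> At Bt; have t0 : 0 <= t by apply: le_trans At.
apply: mx_norm_le => // i j; rewrite /kkt_lin !mxE.
case: fintype.splitP => i' _; rewrite !mxE; case: fintype.splitP => j' _.
- by rewrite mxE normr0.
- rewrite mxE; case: fintype.splitP => i'' _;
    by rewrite (le_trans (mx_norm_entry _ _ _)).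
- rewrite mxE; case: fintype.splitP => j'' _; rewrite mxE;
    by rewrite (le_trans (mx_norm_entry _ _ _)).
- by rewrite mxE normr0.
Qed.

Lemma kkt_rhs_norm (b : 'cV[R]_m) (d : 'cV[R]_s) t :
  `|b| <= t -> `|d| <= t -> `|kkt_rhs b d| <= t.
Proof.
move=> bt dt; have t0 : 0 <= t by apply: le_trans bt.
apply: mx_norm_le => // i j; rewrite /kkt_rhs mxE.
case: fintype.splitP => i' _; last by rewrite mxE normr0.
rewrite mxE; case: fintype.splitP => i'' _;
  by rewrite (le_trans (mx_norm_entry _ _ _)).
Qed.

(** A left kernel vector of [B] in the multiplier block, or a common null vector of [A] and [B] in
    the solution block, is a kernel vector of the system. Conversely, a kernel vector has [x] in
    both null spaces, and then full row rank of [B] forces [u = 0]. *)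
Lemma kkt_unitmxP A B : reflect
  (\rank B = s /\ forall v : 'cV[R]_n, A *m v = 0 -> B *m v = 0 -> v = 0)
  (kkt A B \in unitmx).
Proof.
apply: (iffP idP) => [uK|[rB nAB]].
  have inj (w : 'cV[R]_(m + s + n)) : kkt A B *m w = 0 -> w = 0.
    by move=> Kw; rewrite -[w](mulKmx uK) Kw mulmx0.
  split=> [|v Av Bv].
    apply/eqP; rewrite -[_ == _]/(row_free B) -kermx_eq0.
    apply/eqP/row_matrixP => i; rewrite row0; set u := row i _.
    have uB : u *m B = 0 by apply/sub_kermxP; rewrite row_sub.
    have /inj : kkt A B *m col_mx (col_mx 0 u^T) 0 = 0.
      by rewrite kkt_mulmx !mulmx0 addr0 -trmx_mul uB trmx0 add0r !col_mx0.
    move/eqP; rewrite !col_mx_eq0 => /andP[/andP[_ /eqP u0] _].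
    by apply: trmx_inj; rewrite u0 trmx0.
  have /inj : kkt A B *m col_mx (col_mx 0 0) v = 0.
    by rewrite kkt_mulmx !mulmx0 Av Bv !addr0 !col_mx0.
  by move/eqP; rewrite !col_mx_eq0 => /andP[_ /eqP].
apply: unitmx_cV_inj => w; rewrite -[w]vsubmxK -[usubmx w]vsubmxK.
set r := usubmx _; set u := dsubmx (usubmx w); set x := dsubmx w.
rewrite kkt_mulmx => /eqP; rewrite !col_mx_eq0 -andbA => /and3P[].
rewrite addr_eq0 => /eqP rE /eqP Bx /eqP ABru.
(* Pairing the third block equation with [x], where [B *m x = 0] and [r = - (A *m x)], leaves only
   the squared norm of [A *m x]. *)
have Ax : A *m x = 0.
  apply/eqP; rewrite -l2norm_eq0 -sqrf_eq0 l2norm_dot.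
  have : x^T *m (A^T *m r + B^T *m u) = 0 by rewrite ABru mulmx0.
  rewrite mulmxDr !mulmxA -!trmx_mul Bx trmx0 mul0mx addr0 rE mulmxN.
  by move/eqP; rewrite oppr_eq0 => /eqP; rewrite mulmxA => ->; rewrite mxE.
have x0 : x = 0 by exact: nAB.
have r0 : r = 0 by rewrite rE Ax oppr0.
have u0 : u = 0.
  apply: trmx_inj; rewrite trmx0; apply: (@row_free_inj _ _ _ _ B).
    by rewrite /row_free rB.
  rewrite mul0mx; apply: trmx_inj; rewrite trmx_mul trmxK trmx0.
  by rewrite r0 mulmx0 add0r in ABru.
by rewrite r0 u0 x0 !col_mx0.
Qed.

Lemma lse_solE A B b d : kkt A B \in unitmx ->
  lse_sol A B b d = pinv (A *m projP B) *m b + pinvBA A B *m d.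
Proof.
move=> /kkt_unitmxP[rB nAB]; apply: xget_unique.
  exact/lse_minimizerE.
by move=> y /lse_minimizerE; apply.
Qed.

(** The third block row makes [r] orthogonal to [A *m (y - x)] for every feasible [y], as [y - x] is
    a null vector of [B]; Pythagoras then gives minimality. *)
Lemma kkt_lse_sol A B b d (r : 'cV[R]_m) (u : 'cV[R]_s) (x : 'cV[R]_n) :
  kkt A B \in unitmx ->
  kkt A B *m col_mx (col_mx r u) x = kkt_rhs b d -> lse_sol A B b d = x.
Proof.
move=> uK; rewrite kkt_mulmx => /eq_col_mx[/eq_col_mx[rAx Bx] ABru].
rewrite lse_solE//; apply/esym.
have [rB nAB] := kkt_unitmxP _ _ uK.
apply/lse_minimizerE => //; split=> // y By.
have -> : b - A *m x = r by rewrite -rAx addrK.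
have -> : b - A *m y = r - A *m (y - x).
  by rewrite -rAx mulmxBr opprB addrA.
set w := A *m _.
have rw : w^T *m r = 0.
  have Bw : B *m (y - x) = 0 by rewrite mulmxBr By Bx subrr.
  move/eqP: ABru; rewrite addr_eq0 => /eqP ABru.
  by rewrite /w trmx_mul -mulmxA ABru mulmxN mulmxA -trmx_mul Bw trmx0 mul0mx oppr0.
rewrite -(@ler_pXn2r _ 2) ?nnegrE ?l2norm_ge0// !l2norm_dot.
rewrite [(r - w)^T]linearB/= mulmxBl !mulmxBr rw.
have -> : r^T *m w = 0 by rewrite -[w]trmxK -trmx_mul rw trmx0.
rewrite subr0 sub0r opprK [leRHS]mxE lerDl -l2norm_dot; exact: sqr_ge0.
Qed.

(** The multiplier is obtained by solving the invertible system, whose last block is already known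
    to be the minimizer. *)
Lemma lse_sol_kkt A B b d : kkt A B \in unitmx ->
  exists r u, kkt A B *m col_mx (col_mx r u) (lse_sol A B b d) = kkt_rhs b d.
Proof.
move=> uK; set w := invmx (kkt A B) *m kkt_rhs b d.
have Kw : kkt A B *m w = kkt_rhs b d by rewrite mulKVmx.
rewrite -[w]vsubmxK -[usubmx w]vsubmxK in Kw.
by exists (usubmx (usubmx w)), (dsubmx (usubmx w)); rewrite (kkt_lse_sol uK Kw).
Qed.

End KKT.

(** * Closed form of the linearized solution *)

Section Projector.
Context {R : realType} {m n s : nat} {A : 'M[R]_(m, n)} {B : 'M[R]_(s, n)}.
Hypothesis uK : kkt A B \in unitmx.

Let P := projP B.
Let Q := pinv (A *m P).

Lemma mulmx_pinv_row_free : B *m pinv B = 1%:M.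
Proof.
have [rB _] := kkt_unitmxP _ _ uK; have [B1 _ _ _] := pinvP B.
by apply: (@row_free_inj _ _ _ _ B); rewrite /row_free ?rB// B1 mul1mx.
Qed.

Lemma mulmx_projP : B *m P = 0.
Proof. by rewrite /P mulmxBr mulmx1 mulmxA mulmx_pinv_row_free mul1mx subrr. Qed.

Lemma projP_idem : P *m P = P.
Proof.
by rewrite {1}/P {1}/projP mulmxBl mul1mx -mulmxA mulmx_projP mulmx0 subr0.
Qed.

Lemma projP_sym : P^T = P.
Proof. by have [_ _ _ B4] := pinvP B; rewrite /P /projP linearB/= trmx1 B4. Qed.

(** The range of [Q] lies in that of [(A *m P)^T = P *m A^T], and [P] fixes its own range. *)
Lemma projP_pinv : P *m Q = Q.
Proof.
have [_ Q2 _ Q4] : moore_penrose (A *m P) Q := pinvP _.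
have PQA : P *m (Q *m (A *m P)) = Q *m (A *m P).
  by rewrite -Q4 !trmx_mul projP_sym !mulmxA projP_idem.
by rewrite -{1}Q2 mulmxA PQA Q2.
Qed.

Lemma mulmx_pinvAP : B *m Q = 0.
Proof. by rewrite -projP_pinv mulmxA mulmx_projP mul0mx. Qed.

Lemma mulmx_pinvBA : B *m pinvBA A B = 1%:M.
Proof.
rewrite /pinvBA -/P -/Q mulmxA mulmxBr mulmx1 mulmxA mulmx_pinvAP mul0mx subr0.
exact: mulmx_pinv_row_free.
Qed.

(** The columns of the difference lie in the range of [P] and are killed by both [A] and [B], so the
    null space condition makes them zero. *)
Lemma pinvAP_mulmx : Q *m (A *m P) = P.
Proof.
have [Q1 _ _ _] : moore_penrose (A *m P) Q := pinvP _; have [_ nAB] := kkt_unitmxP _ _ uK.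
apply/eqP; rewrite -subr_eq0; apply/eqP/matrixP => i j.
set W := _ - _; suff Wj : col j W = 0.
  by have /colP/(_ i) := Wj; rewrite !mxE.
have PW : P *m W = W.
  by rewrite /W mulmxBr (mulmxA P Q) projP_pinv projP_idem.
have AW : A *m W = 0.
  by rewrite -PW mulmxA /W mulmxBr (mulmxA _ Q) Q1 -mulmxA projP_idem subrr.
have BW : B *m W = 0 by rewrite -PW mulmxA mulmx_projP mul0mx.
by rewrite colE; apply: nAB; rewrite mulmxA ?AW ?BW mul0mx.
Qed.

Lemma mulmx_pinvAP_sym : (A *m Q)^T = A *m Q.
Proof.
have [_ _ Q3 _] : moore_penrose (A *m P) Q := pinvP _.
by rewrite -projP_pinv (mulmxA A) Q3.
Qed.

End Projector.

(** With [Q = pinv C], both products of [C^T *m C] and [Q *m Q^T] equal the orthogonal projector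
    [Q *m C]. *)
Lemma pinv_gram (R : realType) (m n : nat) (C : 'M[R]_(m, n)) :
  pinv (C^T *m C) = pinv C *m (pinv C)^T.
Proof.
set Q := pinv C; have [Q1 Q2 Q3 Q4] : moore_penrose C Q := pinvP C.
apply: moore_penrose_unique (pinvP _) _.
have CQ : C^T *m C *m (Q *m Q^T) = Q *m C.
  by rewrite -mulmxA (mulmxA C) -Q3 -!trmx_mul (mulmxA Q) Q2 Q4.
have QC : Q *m Q^T *m (C^T *m C) = Q *m C.
  by rewrite -mulmxA (mulmxA Q^T) -trmx_mul Q3 Q1.
split; rewrite ?CQ ?QC //; last by rewrite mulmxA Q2.
by rewrite -Q4 mulmxA -trmx_mul mulmxA Q1.
Qed.

Section KKTSolution.
Context {R : realType} {m n s : nat} {A : 'M[R]_(m, n)} {B : 'M[R]_(s, n)}.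
Variables (r : 'cV[R]_m) (u : 'cV[R]_s) (x : 'cV[R]_n).
Hypothesis uK : kkt A B \in unitmx.
Let z := col_mx (col_mx r u) x.

(** The transposed third block equation is multiplied on the right by [pinvBA A B], a right inverse
    of [B]. This explains the row vector in [M2]. *)
Lemma kkt_multiplier b d :
  kkt A B *m z = kkt_rhs b d -> u^T = - (r^T *m A *m pinvBA A B).
Proof.
rewrite kkt_mulmx => /eq_col_mx[_ /eqP].
rewrite addr_eq0 => /eqP ABru; apply: trmx_inj.
rewrite trmxK linearN/= trmx_mul (trmx_mul r^T) trmxK ABru mulmxN opprK.
by rewrite mulmxA -trmx_mul mulmx_pinvBA// trmx1 mul1mx.
Qed.

(** Block elimination, done by substituting the three block equations into the right-hand side and
    reducing it to [dx]. *)
Lemma kkt_differential (dr : 'cV[R]_m) (du : 'cV[R]_s) (dx : 'cV[R]_n)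
    (dA : 'M[R]_(m, n)) (dB : 'M[R]_(s, n)) db dd :
  kkt A B *m col_mx (col_mx dr du) dx = kkt_rhs db dd - kkt_lin dA dB *m z ->
  dx = pinv ((A *m projP B)^T *m (A *m projP B)) *m (dA^T *m r + dB^T *m u) +
       pinv (A *m projP B) *m (db - dA *m x) + pinvBA A B *m (dd - dB *m x).
Proof.
rewrite kkt_mulmx kkt_lin_mulmx /kkt_rhs opp_col_mx add_col_mx opp_col_mx.
rewrite add_col_mx => /eq_col_mx[/eq_col_mx[drE BdxE] /eqP].
rewrite add0r eq_sym eqr_oppLR => /eqP ->.
set Q := pinv (A *m projP B).
have -> : pinv ((A *m projP B)^T *m (A *m projP B)) = Q *m Q^T by exact: pinv_gram.
(* The term in [du] vanishes since [B *m Q = 0]; the one in [dr] will cancel against the second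
   summand. *)
have -> : Q *m Q^T *m - (A^T *m dr + B^T *m du) = - (Q *m dr).
  have [_ Q2 _ _] : moore_penrose (A *m projP B) Q := pinvP _.
  have QAQ : Q *m (A *m Q) = Q.
    by rewrite -[X in A *m X](projP_pinv uK) (mulmxA A) mulmxA Q2.
  rewrite mulmxN -(mulmxA Q) mulmxDr !(mulmxA Q^T) -!trmx_mul.
  by rewrite (mulmx_pinvAP uK) trmx0 mul0mx addr0 (mulmx_pinvAP_sym uK) mulmxA QAQ.
rewrite -drE -BdxE mulmxDr addrA addNr add0r /pinvBA -/Q.
(* [w] is the component of [dx] orthogonal to the null space of [B]; the other component is fixed by
   [Q *m A]. *)
set w := pinv B *m (B *m dx).
have Pdx : projP B *m dx = dx - w by rewrite /projP mulmxBl mul1mx -mulmxA.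
have QAPdx : Q *m (A *m (dx - w)) = dx - w.
  by rewrite -Pdx mulmxA mulmxA -(mulmxA Q) pinvAP_mulmx.
rewrite -(mulmxA _ (pinv B)) -/w mulmxBl mul1mx -(mulmxA Q) addrCA -!mulmxBr.
by rewrite QAPdx addrC subrK.
Qed.
End KKTSolution.

(** * Frechet derivative *)

Lemma mx_norm_dsubmx (R : realType) (p q n : nat) (w : 'M[R]_(p + q, n)) :
  `|dsubmx w| <= `|w|.
Proof. by apply: mx_norm_le => // i j; rewrite mxE mx_norm_entry. Qed.

Section Differential.
Context {R : realType} {m n s k : nat}.
Local Notation data := ('M[R]_(m, n) * 'M[R]_(s, n) * 'cV[R]_m * 'cV[R]_s)%type.
Variables (L : 'M[R]_(n, k)) (A : 'M[R]_(m, n)) (B : 'M[R]_(s, n)).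
Variables (b : 'cV[R]_m) (d : 'cV[R]_s) (r : 'cV[R]_m) (u : 'cV[R]_s).
Let x := lse_sol A B b d.
Hypothesis uK : kkt A B \in unitmx.
Hypothesis Kz : kkt A B *m col_mx (col_mx r u) x = kkt_rhs b d.

Let z := col_mx (col_mx r u) x.
Let rhs (h : data) : 'cV[R]_(m + s + n) := kkt_rhs h.1.2 h.2.
Let lin (h : data) := kkt_lin h.1.1.1 h.1.1.2.

(** First-order term of [perturbed_solution], restricted to the solution block and mapped by
    [L^T]. *)
Definition lse_diff (h : data) : 'cV[R]_k :=
  L^T *m dsubmx (invmx (kkt A B) *m (rhs h - lin h *m z)).

Let norm4 (h : data) : [/\ `|h.1.1.1| <= `|h|, `|h.1.1.2| <= `|h|,
  `|h.1.2| <= `|h| & `|h.2| <= `|h|].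
Proof. by rewrite !prod_normE !le_max !lexx !orbT. Qed.

Let lin_norm h : `|lin h| <= `|h|.
Proof. by have [? ? _ _] := norm4 h; exact: kkt_lin_norm. Qed.

Let rhs_norm h : `|rhs h| <= `|h|.
Proof. by have [_ _ ? ?] := norm4 h; exact: kkt_rhs_norm. Qed.

Lemma lse_diff_linear : linear lse_diff.
Proof.
move=> a h h'; rewrite /lse_diff.
have -> : lin (a *: h + h') = a *: lin h + lin h'.
  rewrite /lin /kkt_lin/= scale_block_mx add_block_mx !scaler0 !addr0.
  rewrite scale_col_mx add_col_mx scale_row_mx add_row_mx.
  by rewrite !linearP.
have -> : rhs (a *: h + h') = a *: rhs h + rhs h'.
  by rewrite /rhs /kkt_rhs/= !scale_col_mx !add_col_mx scaler0 addr0.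
rewrite mulmxDl -scalemxAl opprD addrACA -scalerBr.
by rewrite mulmxDr -scalemxAr !linearP.
Qed.

Lemma lse_diff_norm : exists2 c : R, 0 <= c & forall h, `|lse_diff h| <= c * `|h|.
Proof.
pose N := (m + s + n)%:R : R.
exists (n%:R * `|L^T| * (N * `|invmx (kkt A B)| * (1 + N * `|z|))) => [|h].
  by rewrite !mulr_ge0// addr_ge0// mulr_ge0.
apply: le_trans (mx_norm_mulmx _ _) _; rewrite -!mulrA 2?ler_wpM2l//.
apply: le_trans (mx_norm_dsubmx _) _.
apply: le_trans (mx_norm_mulmx _ _) _; rewrite -!mulrA 2?ler_wpM2l//.
apply: le_trans (ler_normB _ _) _; rewrite mulrDl mul1r lerD//.
apply: le_trans (mx_norm_mulmx _ _) _.
by rewrite -mulrA -mulrA ler_wpM2l// mulrC ler_wpM2l.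
Qed.

Lemma lse_g_remainder : exists2 c : R, 0 <= c & exists2 e : R, 0 < e &
  forall h : data, `|h| <= e ->
  `|lse_g L (h + (A, B, b, d)) - (lse_g L (A, B, b, d) + lse_diff h)|
    <= c * `|h| ^+ 2.
Proof.
have [c c0 [e e0 he]] := perturbed_solution z uK.
have [e' e'0 he'] := perturbed_unitmx uK.
exists (n%:R * `|L^T| * c); first by rewrite !mulr_ge0.
(* The first radius validates the expansion; the second keeps the perturbed system invertible, so
   that its last block is the perturbed minimizer. *)
exists (Num.min e e') => [|h]; first by rewrite lt_min e0.
rewrite le_min => /andP[hle hle'].
case: h hle hle' => [[[dA dB] db] dd]; set h := (dA, dB, db, dd) => hle hle'.
have uKh : kkt (dA + A) (dB + B) \in unitmx.
  rewrite [dA + _]addrC [dB + _]addrC kktD he'//.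
  exact: le_trans (lin_norm h) hle'.
have [r' [u' Kh]] := lse_sol_kkt (db + b) (dd + d) uKh.
rewrite /lse_g/= -/x; set x' := lse_sol _ _ _ _ in Kh *.
set z' := col_mx _ x' in Kh.
have Ez : (kkt A B + lin h) *m z' = kkt A B *m z + rhs h.
  rewrite /lin/= -kktD ![_ + dA]addrC ![_ + dB]addrC Kh Kz /rhs /kkt_rhs/=.
  by rewrite !add_col_mx addr0 [db + b]addrC [dd + d]addrC.
have := he _ _ _ _ hle (lin_norm h) (rhs_norm h) Ez.
rewrite /lse_diff -mulmxDr -mulmxBr => hz.
apply: le_trans (mx_norm_mulmx _ _) _; rewrite -!(mulrA (_ * _)) ler_wpM2l ?mulr_ge0//.
apply: le_trans _ hz; apply: le_trans _ (mx_norm_dsubmx _).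
set y := invmx _ *m _.
by rewrite !(linearB dsubmx)/= !col_mxKd opprD addrA.
Qed.

Lemma diff_lse_g : 'd (lse_g L) (A, B, b, d) = lse_diff :> (data -> 'cV[R]_k).
Proof.
pose D : {linear data -> 'cV[R]_k} :=
  HB.pack lse_diff (GRing.isLinear.Build _ _ _ _ _ lse_diff_linear).
apply: (@diff_unique _ _ _ _ D).
  apply/linear_bounded_continuous/linear_boundedP.
  have [c c0 hc] := lse_diff_norm.
  apply: filterS (nbhs_pinfty_ge (num_real c)) => q cq h.
  by apply: le_trans (hc h) _; rewrite ler_wpM2r.
have [c c0 [e e0 he]] := lse_g_remainder.
apply/eqaddoP => eps eps0; near=> h.
have he1 : `|h| <= e by near: h; exact: (@nbhs0_le R data e e0).
apply: le_trans (he _ he1) _; rewrite expr2 mulrA ler_wpM2r//.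
(* This turns the quadratic bound into [eps * |h|]; the summand [1] avoids a zero denominator. *)
have : `|h| <= eps / (c + 1).
  by near: h; apply: (@nbhs0_le R data (eps / (c + 1))); rewrite divr_gt0// ltr_wpDl.
rewrite ler_pdivlMr ?ltr_wpDl// => hh.
have := normr_ge0 h; nra.
Unshelve. all: by end_near. Qed.

End Differential.

(** * Spectral norm *)

Lemma l2normZ (R : realType) (n : nat) (a : R) (v : 'cV[R]_n) :
  l2norm (a *: v) = `|a| * l2norm v.
Proof.
apply/eqP; rewrite -(@eqrXn2 _ 2) ?l2norm_ge0 ?mulr_ge0 ?l2norm_ge0//.
rewrite exprMn !l2norm_sqr real_normK ?num_real// mulr_sumr; apply/eqP.
by apply: eq_bigr => i _; rewrite mxE exprMn.
Qed.

Lemma l2norm_col_mx (R : realType) (p q : nat) (v : 'cV[R]_p) (w : 'cV[R]_q) :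
  l2norm (col_mx v w) ^+ 2 = l2norm v ^+ 2 + l2norm w ^+ 2.
Proof. by rewrite !l2norm_dot tr_col_mx mul_row_col mxE. Qed.

Lemma l2norm_isometry (R : realType) (p q : nat) (W : 'M[R]_(p, q)) v :
  W^T *m W = 1%:M -> l2norm (W *m v) = l2norm v.
Proof.
move=> WW; apply/eqP; rewrite -(@eqrXn2 _ 2) ?l2norm_ge0// !l2norm_dot.
by rewrite trmx_mul -mulmxA (mulmxA W^T) WW mul1mx.
Qed.

Section SpectralNorm.
Context {R : realType} {p q : nat}.
Variable C : 'M[R]_(p, q).

Let sumsq_continuous (a b : nat) (f : 'rV[R]_a -> 'I_b -> R) :
  (forall i, continuous (fun v => f v i)) ->
  continuous (fun v => \sum_i f v i ^+ 2).
Proof.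
move=> fc; apply: continuous_big => [|i _]; first exact: add_continuous.
by move=> v; exact: (@continuous_comp _ _ _ (fun v => f v i) (fun x : R => x ^+ 2) v
  (fc i v) (@exprn_continuous R 2 _)).
Qed.

(** The squared norm is maximized over the compact unit ball; row vectors are used to match the
    extreme value theorem applied here. *)
Lemma specnorm_attained : exists2 v : 'cV[R]_q, l2norm v <= 1 &
  forall w : 'cV[R]_q, l2norm w <= 1 -> l2norm (C *m w) <= l2norm (C *m v).
Proof.
pose ball := [set v : 'rV[R]_q | \sum_i v 0 i ^+ 2 <= 1]%classic.
have ballE (v : 'rV[R]_q) : ball v <-> l2norm v^T <= 1.
  rewrite -(@ler_pXn2r _ 2) ?nnegrE ?l2norm_ge0// expr1n l2norm_sqr /ball/=.
  by have -> : \sum_i v^T i 0 ^+ 2 = \sum_i v 0 i ^+ 2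
    by apply: eq_bigr => i _; rewrite mxE.
have cball : compact ball.
  apply: bounded_closed_compact.
    exists 1; split => // M M1 v /= bv; apply: mx_norm_le => [|i j].
      exact: le_trans ler01 (ltW M1).
    apply: le_trans (ltW M1); rewrite (ord1 i) -(@ler_pXn2r _ 2) ?nnegrE//.
    rewrite expr1n real_normK ?num_real//; apply: le_trans bv.
    by rewrite (bigD1 j)//= lerDl sumr_ge0// => l _; exact: sqr_ge0.
  apply: (continuous_closedP _).1 (@closed_le _ 1).
  by apply: sumsq_continuous => i v; exact: coord_continuous.
pose f (v : 'rV[R]_q) := \sum_i (C *m v^T) i 0 ^+ 2.
have fc : continuous f.
  apply: sumsq_continuous => i.
  have -> : (fun v : 'rV[R]_q => (C *m v^T) i 0) = (fun v => \sum_j C i j * v 0 j).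
    by apply/funext => v; rewrite mxE; apply: eq_bigr => j _; rewrite mxE.
  apply: continuous_big => [|j _ v]; first exact: add_continuous.
  by apply: continuousM; [exact: cst_continuous|exact: coord_continuous].
have ball0 : ball 0.
  by rewrite /ball/= big1// => i _; rewrite mxE expr0n.
have [c] := EVT_max_rV (ex_intro _ 0 ball0) cball (continuous_subspaceT fc).
rewrite inE => /ballE c1 cmax; exists c^T => // w w1.
rewrite -(@ler_pXn2r _ 2) ?nnegrE ?l2norm_ge0// !l2norm_sqr.
by have := cmax w^T; rewrite inE /f trmxK; apply; apply/ballE; rewrite trmxK.
Qed.

(** By homogeneity each ratio is at most the maximum over the unit ball. A nonzero maximizer attains
    it, because dividing by a norm at most 1 cannot decrease the value; a zero maximizer makes all
    ratios vanish. *)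
Lemma setmax_specnorm (T : Type) (D : set T) (num den : T -> R) :
  (forall h, D h -> exists2 v : 'cV[R]_q, v != 0 &
    num h = l2norm (C *m v) /\ den h = l2norm v) ->
  (forall v : 'cV[R]_q, v != 0 -> exists2 h, D h &
    num h = l2norm (C *m v) /\ den h = l2norm v) ->
  setmax [set num h / den h | h in D]%classic = specnorm C.
Proof.
move=> Dv vD; have [v v1 vmax] := specnorm_attained.
have -> : specnorm C = l2norm (C *m v).
  apply/eqP; rewrite eq_le; apply/andP; split.
    by apply: ge_sup => [|_ [w /= w1 <-]]; [exists (l2norm (C *m v)), v|exact: vmax].
  apply: ub_le_sup; last by exists v.
  by exists (l2norm (C *m v)) => _ [w /= w1 <-]; exact: vmax.
have ratio_le (w : 'cV[R]_q) : w != 0 -> l2norm (C *m w) / l2norm w <= l2norm (C *m v).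
  rewrite -l2norm_eq0 => w0.
  have := vmax ((l2norm w)^-1 *: w); rewrite -scalemxAr !l2normZ.
  rewrite ger0_norm ?invr_ge0 ?l2norm_ge0// mulVf// mulrC; exact.
have [v0|v0] := eqVneq v 0; last first.
  apply: setmaxP => [|_ [h /Dv[w w0 [-> ->]] <-]]; last exact: ratio_le.
  have [h Dh [numE denE]] := vD _ v0; exists h => //; rewrite numE denE.
  apply/eqP; rewrite eq_le ratio_le//= ler_peMr ?l2norm_ge0//.
  by rewrite -invr1 lef_pV2 ?posrE ?ltr01// lt_def l2norm_eq0 v0 l2norm_ge0.
have Cv0 : l2norm (C *m v) = 0 by apply/eqP; rewrite l2norm_eq0 v0 mulmx0.
have ratio0 (w : 'cV[R]_q) : w != 0 -> l2norm (C *m w) / l2norm w = 0.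
  move=> w0; apply/eqP; rewrite eq_le divr_ge0 ?l2norm_ge0// andbT -Cv0.
  exact: ratio_le.
rewrite Cv0; have [[h Dh]|D0] := pselect (exists h, D h).
  apply: setmaxP => [|_ [h' /Dv[w w0 [-> ->]] <-]]; last by rewrite ratio0.
  by exists h => //; have [w w0 [-> ->]] := Dv _ Dh; rewrite ratio0.
(* Here [D] is empty, and the default value 0 of [setmax] agrees with the spectral norm. *)
by apply: xgetPN => _ [[h Dh _] _]; apply: D0; exists h.
Qed.

End SpectralNorm.

(** * Vectorization and Kronecker products *)

Definition unvec (R : realType) (m n : nat) (w : 'cV[R]_(n * m)) : 'M[R]_(m, n) :=
  \matrix_(i, j) w (mxtens_index (j, i)) 0.

Lemma unvecK (R : realType) (m n : nat) :
  cancel (@unvec R m n) (@vec R m n).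
Proof. by move=> w; apply/colP => l; rewrite !mxE -surjective_pairing mxtens_unindexK. Qed.

Lemma vec_eq0 (R : realType) (m n : nat) (Y : 'M[R]_(m, n)) :
  (vec Y == 0) = (Y == 0).
Proof.
apply/eqP/eqP => [/colP Y0|->]; last by apply/colP => l; rewrite !mxE.
apply/matrixP => i j; have := Y0 (mxtens_index (j, i)).
by rewrite !mxE mxtens_indexK.
Qed.

Lemma big_mxtens (R : realType) (m n : nat) (F : 'I_m -> 'I_n -> R) :
  \sum_(l < m * n) F (mxtens_unindex l).1 (mxtens_unindex l).2 =
  \sum_i \sum_j F i j.
Proof.
rewrite pair_bigA (reindex (@mxtens_index m n)).
  by apply: eq_bigr => ij _; rewrite mxtens_indexK.
by exists (@mxtens_unindex m n) => l _; rewrite (mxtens_indexK, mxtens_unindexK).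
Qed.

Lemma l2norm_vec (R : realType) (m n : nat) (Y : 'M[R]_(m, n)) :
  l2norm (vec Y) = frobnorm Y.
Proof.
rewrite /l2norm /frobnorm exchange_big/=; congr Num.sqrt.
rewrite -(big_mxtens (fun j i => Y i j ^+ 2)).
by apply: eq_bigr => l _; rewrite mxE.
Qed.

Lemma rowkron_vec (R : realType) (k p q : nat)
    (w : 'rV[R]_p) (C : 'M[R]_(k, q)) (Y : 'M[R]_(q, p)) :
  rowkron w C *m vec Y = C *m Y *m w^T.
Proof.
apply/colP => i; rewrite -mulmxA !mxE.
under [RHS]eq_bigr do rewrite mxE mulr_sumr.
rewrite exchange_big/= -(big_mxtens (fun c l => C i l * (Y l c * w^T c 0))).
apply: eq_bigr => l _; rewrite castmxE/= cast_ord_id !mxE.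
(* The cast identifies the row [i] with the pair [(0, i)] of the Kronecker product. *)
have -> : (mxtens_unindex (cast_ord (esym (mul1n k)) i)).2 = i.
  rewrite (_ : cast_ord _ i = mxtens_index (0 : 'I_1, i)) ?mxtens_indexK//.
  exact: val_inj.
by rewrite (ord1 (mxtens_unindex _).1); ring.
Qed.

(** * Normalized structure matrices *)

Section StructureMatrix.
Context {R : realType} {p l : nat}.
Variable Phi : 'M[R]_(p, l).
Hypothesis Phi_neq0 : forall j, col j Phi != 0.
Hypothesis Phi_orth : forall i j, i != j -> (col i Phi)^T *m col j Phi = 0.

Lemma colnorms_unitmx : colnorms Phi \in unitmx.
Proof.
rewrite unitmxE det_diag unitfE; apply/prodf_neq0 => j _.
by rewrite mxE l2norm_eq0.
Qed.

(** With [D = colnorms Phi], orthogonality gives [Phi^T *m Phi = D *m D], which the two factors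
    [invmx D] cancel. *)
Lemma normalized_columns : let W := Phi *m invmx (colnorms Phi) in W^T *m W = 1%:M.
Proof.
have DT : (colnorms Phi)^T = colnorms Phi by exact: tr_diag_mx.
rewrite /= trmx_mul trmx_inv DT.
have PhiPhi : Phi^T *m Phi = colnorms Phi *m colnorms Phi.
  rewrite mulmx_diag; apply/matrixP => i j; rewrite !mxE.
  have -> : \sum_c Phi^T i c * Phi c j = ((col i Phi)^T *m col j Phi) 0 0.
    by rewrite mxE; apply: eq_bigr => c _; rewrite !mxE.
  have [->|ij] := eqVneq i j; last by rewrite Phi_orth// mxE mulr0n.
  by rewrite mulr1n -l2norm_dot expr2.
rewrite -mulmxA (mulmxA Phi^T) PhiPhi !mulmxA mulVmx ?colnorms_unitmx//.
by rewrite mul1mx mulmxV ?colnorms_unitmx.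
Qed.

End StructureMatrix.

(** * Derivative and structures in weighted coordinates *)

Section ConditionMatrix.
Context {R : realType} {m n s k : nat}.
Local Notation data := ('M[R]_(m, n) * 'M[R]_(s, n) * 'cV[R]_m * 'cV[R]_s)%type.
Variables (L : 'M[R]_(n, k)) (A : 'M[R]_(m, n)) (B : 'M[R]_(s, n)).
Variables (b : 'cV[R]_m) (d : 'cV[R]_s) (aA aB ab ad : R).
Hypotheses (aA_gt0 : 0 < aA) (aB_gt0 : 0 < aB) (ab_gt0 : 0 < ab) (ad_gt0 : 0 < ad).

(** The weights turn the Euclidean norm into the weighted Frobenius norm and cancel the divisors in
    the blocks of [Mg]. *)
Definition wvec (h : data) : 'cV[R]_(n * m + (n * s + (m + s))) :=
  col_mx (aA *: vec h.1.1.1)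
    (col_mx (aB *: vec h.1.1.2) (col_mx (ab *: h.1.2) (ad *: h.2))).

Lemma wvec_eq0 h : (wvec h == 0) = (h == 0).
Proof.
case: h => [[[dA dB] db] dd]; rewrite !col_mx_eq0 !scaler_eq0 !vec_eq0/=.
by rewrite (gt_eqF aA_gt0) (gt_eqF aB_gt0) (gt_eqF ab_gt0) (gt_eqF ad_gt0) -!pair_eqE/= -!andbA.
Qed.

Lemma l2norm_wvec h : l2norm (wvec h) = weighted_frobnorm aA aB ab ad h.
Proof.
case: h => [[[dA dB] db] dd].
have sqrP (t : nat) (v : 'cV[R]_t) a : 0 < a ->
    l2norm (a *: v) ^+ 2 = a ^+ 2 * l2norm v ^+ 2.
  by move=> a0; rewrite l2normZ gtr0_norm// exprMn.
rewrite /weighted_frobnorm -[LHS]ger0_norm ?l2norm_ge0// -sqrtr_sqr.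
by rewrite !l2norm_col_mx !sqrP// !l2norm_vec/= !addrA.
Qed.

Hypothesis uK : kkt A B \in unitmx.
Let x := lse_sol A B b d.
Let r := b - A *m x.

(** [vecperm] transposes [dA] and [dB], and each Kronecker row [rowkron w C] acts on [vec Y] as
    [C *m Y *m w^T]; the result is [kkt_differential] multiplied by [L^T]. *)
Lemma Mg_wvec h :
  Mg aA aB ab ad L A B x r *m wvec h = 'd (lse_g L) (A, B, b, d) h.
Proof.
case: h => [[[dA dB] db] dd].
have [r' [u Kz]] := lse_sol_kkt b d uK.
have r'E : r' = r.
  move: Kz; rewrite kkt_mulmx => /eq_col_mx[/eq_col_mx[rAx _] _].
  by apply/esym/eqP; rewrite subr_eq rAx.
rewrite {}r'E in Kz; have uE : (r^T *m A *m pinvBA A B)^T = - u.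
  by rewrite -[u]trmxK (kkt_multiplier uK Kz) [(- _)^T]linearN opprK.
rewrite (diff_lse_g L uK Kz) /lse_diff/=.
set w := invmx _ *m _.
have Kw : kkt A B *m w = kkt_rhs db dd - kkt_lin dA dB *m col_mx (col_mx r u) x.
  by rewrite mulKVmx.
rewrite -[w]vsubmxK -[usubmx w]vsubmxK in Kw.
rewrite (kkt_differential uK Kw) -/x.
rewrite /Mg !mul_row_col /M1 /M2 /M3 /M4 /=.
rewrite mulNmx -!scalemxAl -!scalemxAr !scalerA !mulVf ?gt_eqF// !scale1r.
rewrite mulmxBl mulmxDl -!(mulmxA (rowkron _ _)) !vecpermE !rowkron_vec !trmxK.
rewrite uE.
set G := pinv (_^T *m _); set Q := pinv (_ *m _); set H := pinvBA A B.
clearbody G Q H; move: (r) => r0; rewrite !mulmxDr !mulmxN !mulmxA.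
move: (L^T *m G *m dA^T *m r0) (L^T *m Q *m dA *m x) (L^T *m G *m dB^T *m u).
move: (L^T *m H *m dB *m x) (L^T *m Q *m db) (L^T *m H *m dd) => a1 a2 a3 a4 a5 a6.
by apply/matrixP => i j; rewrite !mxE; ring.
Qed.

End ConditionMatrix.

(** Since [colnorms Phi] is invertible and [a] is nonzero, normalizing and weighting only change the
    parameter vector. *)
Lemma structure_matrixP (R : realType) (m n l : nat)
    (S : {vspace 'M[R]_(m, n)}) (Phi : 'M[R]_(n * m, l)) (a : R) Y :
  structure_matrix S Phi -> 0 < a ->
  Y \in S <-> exists t, a *: vec Y = Phi *m invmx (colnorms Phi) *m t.
Proof.
move=> [Phi0 _ SPhi] a0; rewrite SPhi; split=> [[t ->]|[t Yt]].
  exists (colnorms Phi *m (a *: t)).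
  by rewrite mulmxA mulmxKV ?colnorms_unitmx// -scalemxAr.
exists (a^-1 *: (invmx (colnorms Phi) *m t)).
by rewrite -scalemxAr mulmxA -Yt scalerA mulVf ?gt_eqF// scale1r.
Qed.

Section StructBlock.
Context {R : realType} {m n s k1 k2 : nat}.
Variables (Phi1 : 'M[R]_(n * m, k1)) (Phi2 : 'M[R]_(n * s, k2)).

Lemma struct_block_mulmx t1 t2 (w : 'cV[R]_(m + s)) :
  struct_block Phi1 Phi2 *m col_mx t1 (col_mx t2 w) =
  col_mx (Phi1 *m invmx (colnorms Phi1) *m t1)
    (col_mx (Phi2 *m invmx (colnorms Phi2) *m t2) w).
Proof.
rewrite /struct_block -scalar_mx_block !mul_block_col !mul0mx mul1mx.
by rewrite !addr0 !add0r.
Qed.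

Lemma struct_block_isometry (S1 : {vspace 'M[R]_(m, n)}) (S2 : {vspace 'M[R]_(s, n)}) :
  structure_matrix S1 Phi1 -> structure_matrix S2 Phi2 ->
  (struct_block Phi1 Phi2)^T *m struct_block Phi1 Phi2 = 1%:M.
Proof.
move=> [Phi1_neq0 Phi1_orth _] [Phi2_neq0 Phi2_orth _].
rewrite /struct_block -scalar_mx_block !tr_block_mx !trmx0 !mulmx_block.
rewrite !mul0mx !mulmx0 !addr0 !add0r trmx1 mul1mx.
by rewrite !normalized_columns// -!scalar_mx_block.
Qed.

End StructBlock.

(** * The structured condition number as a spectral norm *)

Theorem theorem3p1 (R : realType) (m n s k : nat)
  (hmsn : (n <= m + s)%N) (hsn : (s <= n)%N) (hkn : (k <= n)%N)
  (S1 : {vspace 'M[R]_(m, n)}) (S2 : {vspace 'M[R]_(s, n)})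
  (k1 k2 : nat) (Phi1 : 'M[R]_(n * m, k1)) (Phi2 : 'M[R]_(n * s, k2))
  (hPhi1 : structure_matrix S1 Phi1) (hPhi2 : structure_matrix S2 Phi2)
  (A : 'M[R]_(m, n)) (B : 'M[R]_(s, n)) (b : 'cV[R]_m) (d : 'cV[R]_s)
  (hA : A \in S1) (hB : B \in S2)
  (rankB : \rank B = s)
  (nullAB : forall v : 'cV[R]_n, A *m v = 0 -> B *m v = 0 -> v = 0)
  (L : 'M[R]_(n, k)) (aA aB ab ad : R)
  (aA_gt0 : 0 < aA) (aB_gt0 : 0 < aB) (ab_gt0 : 0 < ab) (ad_gt0 : 0 < ad) :
  let x := lse_sol A B b d in
  let r := b - A *m x in
  kappaS S1 S2 aA aB ab ad L A B b d =
  specnorm (Mg aA aB ab ad L A B x r *m struct_block Phi1 Phi2).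
Proof.
move=> x r; have uK : kkt A B \in unitmx by apply/kkt_unitmxP.
have SBiso := struct_block_isometry hPhi1 hPhi2.
(* Corresponding [h] and [v] have equal numerators and equal denominators, the latter by isometry of
   the block matrix. *)
have normE h v : wvec aA aB ab ad h = struct_block Phi1 Phi2 *m v ->
    l2norm ('d (lse_g L) (A, B, b, d) h) =
      l2norm (Mg aA aB ab ad L A B x r *m struct_block Phi1 Phi2 *m v) /\
    weighted_frobnorm aA aB ab ad h = l2norm v.
  move=> hv; rewrite -mulmxA -hv Mg_wvec//; split=> //.
  by rewrite -l2norm_wvec// hv l2norm_isometry.
apply: setmax_specnorm => [h [h0 /(structure_matrixP _ hPhi1 aA_gt0)[t1 ht1]]|v v0].
  move=> /(structure_matrixP _ hPhi2 aB_gt0)[t2 ht2].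
  pose v := col_mx t1 (col_mx t2 (col_mx (ab *: h.1.2) (ad *: h.2))).
  have hv : wvec aA aB ab ad h = struct_block Phi1 Phi2 *m v.
    by rewrite struct_block_mulmx -ht1 -ht2.
  exists v; last exact: normE.
  apply: contraNneq h0 => v0.
  by rewrite -(wvec_eq0 aA_gt0 aB_gt0 ab_gt0 ad_gt0) hv v0 mulmx0.
(* Conversely, the blocks of [v] give a structured perturbation once weights and vectorization are
   undone. *)
pose t1 := usubmx v; pose t2 := usubmx (dsubmx v).
pose e := usubmx (dsubmx (dsubmx v)); pose f := dsubmx (dsubmx (dsubmx v)).
pose h := (unvec (aA^-1 *: (Phi1 *m invmx (colnorms Phi1) *m t1)),
  unvec (aB^-1 *: (Phi2 *m invmx (colnorms Phi2) *m t2)), ab^-1 *: e, ad^-1 *: f).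
have scaleK a (t : nat) (w : 'cV[R]_t) : 0 < a -> a *: (a^-1 *: w) = w.
  by move=> a0; rewrite scalerA mulfV ?gt_eqF// scale1r.
have hv : wvec aA aB ab ad h = struct_block Phi1 Phi2 *m v.
  rewrite -[v]vsubmxK -[dsubmx v]vsubmxK -[dsubmx (dsubmx v)]vsubmxK.
  by rewrite struct_block_mulmx /wvec/= !unvecK !scaleK.
exists h; last exact: normE.
split.
- rewrite -(wvec_eq0 aA_gt0 aB_gt0 ab_gt0 ad_gt0) hv.
  by rewrite -l2norm_eq0 l2norm_isometry// l2norm_eq0.
- by apply/(structure_matrixP _ hPhi1 aA_gt0); exists t1; rewrite unvecK scaleK.
- by apply/(structure_matrixP _ hPhi2 aB_gt0); exists t2; rewrite unvecK scaleK.
Qed.
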